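(* Let $\mathsf{L}$ be either $\mathbf{MT_0}$ or $\mathbf{MID}$, with its Hilbert-style system. For all $\mathsf{L}$-formulas $\phi$ and $\psi$: if $\phi\models\psi$, then $\phi\vdash_{\mathsf{L}}\psi$.
   Context: **Languages.** Fix a set $\mathrm{Prop}$ of propositional variables $p,q,\dots$. $\mathbf{MT_0}$: classical formulas are $\alpha::=p\mid\bot\mid\alpha\wedge\alpha\mid\alpha\otimes\alpha\mid\alpha\to\alpha\mid\Box\alpha\mid\Diamond\alpha$; formulas are $\phi::=\alpha\mid\; =\!(\alpha_1,\dots,\alpha_n,\beta)\mid\phi\wedge\phi\mid\phi\otimes\phi\mid\phi\vee\phi\mid\phi\to\phi\mid\Box\phi\mid\Diamond\phi$, where $n\ge 0$ and $\alpha,\alpha_i,\beta$ are classical. $\mathbf{MID}$: the same without $\otimes$, i.e. classical formulas are $\alpha::=p\mid\bot\mid\alpha\wedge\alpha\mid\alpha\to\alpha\mid\Box\alpha\mid\Diamond\alpha$ and formulas are $\phi::=\alpha\mid\; =\!(\alpha_1,\dots,\alpha_n,\beta)\mid\phi\wedge\phi\mid\phi\vee\phi\mid\phi\to\phi\mid\Box\phi\mid\Diamond\phi$. $\neg\phi$ abbreviates $\phi\to\bot$, and $\phi\leftrightarrow\psi$ abbreviates $(\phi\to\psi)\wedge(\psi\to\phi)$. **Team semantics.** A Kripke model is $\mathfrak{M}=(W,R,V)$ with $W\neq\emptyset$, $R\subseteq W\times W$, $V:\mathrm{Prop}\to\wp(W)$. A team is any $X\subseteq W$. $R(X)=\{w\in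 W\mid\exists v\in X,\ vRw\}$, $R(w)=R(\{w\})$; $XRY$ means $Y\subseteq R(X)$ and $Y\cap R(w)\ne\emptyset$ for every $w\in X$. Satisfaction: - $\mathfrak{M},X\models p$ iff $X\subseteq V(p)$; $\mathfrak{M},X\models\bot$ iff $X=\emptyset$. - $\mathfrak{M},X\models\phi\wedge\psi$ iff both hold on $X$; $\mathfrak{M},X\models\phi\vee\psi$ iff $\mathfrak{M},X\models\phi$ or $\mathfrak{M},X\models\psi$. - $\mathfrak{M},X\models\phi\otimes\psi$ iff $X=Y\cup Z$ for some $Y,Z\subseteq X$ with $\mathfrak{M},Y\models\phi$, $\mathfrak{M},Z\models\psi$. - $\mathfrak{M},X\models\phi\to\psi$ iff for all $Y\subseteq X$, $\mathfrak{M},Y\models\phi$ implies $\mathfrak{M},Y\models\psi$. - $\mathfrak{M},X\models\Box\phi$ iff $\mathfrak{M},R(X)\models\phi$; $\mathfrak{M},X\models\Diamond\phi$ iff there is $Y\subseteq W$ with $XRY$ and $\mathfrak{M},Y\models\phi$. - $\mathfrak{M},X\models\;=\!(\alpha_1,\dots,\alpha_n,\beta)$ iff for all $w,u\in X$: if ($\mathfrak{M},\{w\}\models\alpha_i\Leftrightarrow\mathfrak{M},\{u\}\models\alpha_i$) for all $1\le i\le n$, then ($\mathfrak{M},\{w\}\models\beta\Leftrightarrow\mathfrak{M},\{u\}\models\beta$). $\phi\models\psi$ means: for all models $\mathfrak{M}$ and teams $X$, $\mathfrak{M},X\models\phi$ implies $\mathfrak{M},X\models\psi$. **Hilbert system of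 $\mathbf{MT_0}$.** Axioms: all instances in the language (with $\phi,\psi,\chi,\theta$ arbitrary formulas and $\alpha,\alpha_i,\beta$ classical formulas) of 1. $\phi\to(\psi\to\phi)$; $(\phi\to(\psi\to\chi))\to((\phi\to\psi)\to(\phi\to\chi))$; $\phi\wedge\psi\to\phi$; $\phi\wedge\psi\to\psi$; $\phi\to(\chi\to(\phi\wedge\chi))$; $\phi\to\phi\vee\psi$; $\psi\to\phi\vee\psi$; $(\phi\to\chi)\to((\psi\to\chi)\to(\phi\vee\psi\to\chi))$; $\bot\to\phi$; 2. $(\alpha\to(\phi\vee\psi))\to(\alpha\to\phi)\vee(\alpha\to\psi)$; $\neg\neg\alpha\to\alpha$; 3. $\Box(\phi\to\psi)\to(\Box\phi\to\Box\psi)$; $\Box(\phi\to\psi)\to(\Diamond\phi\to\Diamond\psi)$; $\neg\Diamond\bot$; $\Diamond(\phi\vee\psi)\to(\Diamond\phi\vee\Diamond\psi)$; $(\Diamond\phi\to\Box\psi)\to\Box(\phi\to\psi)$; 4. $=\!(\alpha_1,\dots,\alpha_k,\beta)\leftrightarrow\big((\alpha_1\vee\neg\alpha_1)\wedge\dots\wedge(\alpha_k\vee\neg\alpha_k)\to(\beta\vee\neg\beta)\big)$ (right side read as $\beta\vee\neg\beta$ if $k=0$); 5. $\phi\to\phi\otimes\psi$; $(\phi\to\alpha)\to((\psi\to\alpha)\to(\phi\otimes\psi\to\alpha))$; $(\phi\to\chi)\to((\psi\to\theta)\to(\phi\otimes\psi\to\chi\otimes\theta))$; $\phi\otimes\psi\to\psi\otimes\phi$;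 $\phi\otimes(\psi\otimes\chi)\to(\phi\otimes\psi)\otimes\chi$; $\phi\otimes(\psi\vee\chi)\to(\phi\otimes\psi)\vee(\phi\otimes\chi)$; 6. $\neg\Box\alpha\to\Diamond\neg\alpha$; $\Box(\phi\vee\psi)\to(\Box\phi\vee\Box\psi)$. Rules: Modus Ponens $\phi,\phi\to\psi/\psi$ and Necessitation $\phi/\Box\phi$. The system of $\mathbf{MID}$ is the same with formulas of $\mathbf{MID}$ and without the axioms in group 5. $\vdash_{\mathsf L}\phi$ means $\phi$ is a theorem; $\phi\vdash_{\mathsf L}\psi$ means $\psi$ is derivable from the assumption $\phi$, where Necessitation is applied only to theorems (equivalently, $\vdash_{\mathsf L}\phi\to\psi$). *)

(* Defs.v *)
From Stdlib Require List.
From mathcomp Require Import all_boot classical_sets.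

Set Implicit Arguments.
Unset Strict Implicit.
Unset Printing Implicit Defensive.

Local Open Scope classical_set_scope.

Inductive logic := MT0 | MID.

Definition has_tensor (L : logic) : bool := if L is MT0 then true else false.

(* The tensor constructors carry a proof of [has_tensor L], so that they are
   uninhabited for L = MID. *)

Inductive cform (Var : Type) (L : logic) : Type :=
  | CVar of Var
  | CBot
  | CAnd of cform Var L & cform Var L
  | CTensor of has_tensor L & cform Var L & cform Var L
  | CImp of cform Var L & cform Var L
  | CBox of cform Var L
  | CDia of cform Var L.

Inductive form (Var : Type) (L : logic) : Type :=
  | FVar of Var
  | FBot
  | FDep of seq (cform Var L) & cform Var L
  | FAnd of form Var L & form Var L
  | FTensor of has_tensor L & form Var L & form Var L
  | FOr of form Var L & form Var L
  | FImp of form Var L & form Var L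
  | FBox of form Var L
  | FDia of form Var L.

Arguments CBot {Var L}.
Arguments FBot {Var L}.
Arguments FVar {Var L} p.
Arguments CVar {Var L} p.

(* In the grammar a conjunction of two classical formulas is literally a
   conjunction of formulas.  [form] therefore has no constructor for classical
   formulas; they are the image of the following injection, which is a coercion. *)
Fixpoint emb (Var : Type) (L : logic) (a : cform Var L) : form Var L :=
  match a with
  | CVar p => FVar p
  | CBot => FBot
  | CAnd a b => FAnd (emb a) (emb b)
  | CTensor h a b => FTensor h (emb a) (emb b)
  | CImp a b => FImp (emb a) (emb b)
  | CBox a => FBox (emb a)
  | CDia a => FDia (emb a)
  end.

Coercion emb : cform >-> form.

Declare Scope form_scope.
Delimit Scope form_scope with F.
Bind Scope form_scope with form.

Definition FNeg (Var : Type) (L : logic) (f : form Var L) := FImp f FBot.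

Definition FIff (Var : Type) (L : logic) (f g : form Var L) :=
  FAnd (FImp f g) (FImp g f).

Notation "f :/\: g" := (FAnd f g) (at level 80, right associativity) : form_scope.
Notation "f :\/: g" := (FOr f g) (at level 85, right associativity) : form_scope.
Notation "f :->: g" := (FImp f g) (at level 90, right associativity) : form_scope.
Notation "f :<->: g" := (FIff f g) (at level 95, no associativity) : form_scope.
Notation ":~ f" := (FNeg f) (at level 35, right associativity) : form_scope.
Notation ":[] f" := (FBox f) (at level 35, right associativity) : form_scope.
Notation ":<> f" := (FDia f) (at level 35, right associativity) : form_scope.

Record model (Var : Type) := Model {
  world :> Type;
  acc : world -> world -> Prop;
  valuation : Var -> set world;
  world_nonempty : inhabited world
}.

Definition reach (Var : Type) (M : model Var) (X : set M) : set M :=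
  [set w | exists2 v, X v & acc v w].

Definition team_acc (Var : Type) (M : model Var) (X Y : set M) : Prop :=
  Y `<=` reach X /\ forall w, X w -> Y `&` reach [set w] !=set0.

(* The semantic clauses are stated on sets of teams, so that they can be shared
   by the satisfaction relations of [cform] and [form]. *)

Definition tvar (Var : Type) (M : model Var) (p : Var) : set (set M) :=
  [set X | X `<=` valuation p].

Definition tbot (Var : Type) (M : model Var) : set (set M) := [set X | X = set0].

Definition tand (Var : Type) (M : model Var) (P Q : set (set M)) : set (set M) :=
  [set X | P X /\ Q X].

Definition tor (Var : Type) (M : model Var) (P Q : set (set M)) : set (set M) :=
  [set X | P X \/ Q X].

Definition ttensor (Var : Type) (M : model Var) (P Q : set (set M)) :
    set (set M) :=
  [set X | exists Y Z : set M, [/\ X = Y `|` Z, P Y & Q Z]].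

Definition timp (Var : Type) (M : model Var) (P Q : set (set M)) : set (set M) :=
  [set X | forall Y : set M, Y `<=` X -> P Y -> Q Y].

Definition tbox (Var : Type) (M : model Var) (P : set (set M)) : set (set M) :=
  [set X | P (reach X)].

Definition tdia (Var : Type) (M : model Var) (P : set (set M)) : set (set M) :=
  [set X | exists2 Y : set M, team_acc X Y & P Y].

Fixpoint csat (Var : Type) (L : logic) (M : model Var) (a : cform Var L) :
    set (set M) :=
  match a with
  | CVar p => @tvar Var M p
  | CBot => @tbot Var M
  | CAnd a b => tand (csat a) (csat b)
  | CTensor _ a b => ttensor (csat a) (csat b)
  | CImp a b => timp (csat a) (csat b)
  | CBox a => tbox (csat a)
  | CDia a => tdia (csat a)
  end.

Arguments csat {Var L} M a X.

Definition tdep (Var : Type) (L : logic) (M : model Var)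
    (s : seq (cform Var L)) (b : cform Var L) : set (set M) :=
  [set X | forall w u, X w -> X u ->
    (forall a, List.In a s -> (csat M a [set w] <-> csat M a [set u])) ->
    (csat M b [set w] <-> csat M b [set u])].

Fixpoint sat (Var : Type) (L : logic) (M : model Var) (f : form Var L) :
    set (set M) :=
  match f with
  | FVar p => @tvar Var M p
  | FBot => @tbot Var M
  | FDep s b => @tdep Var L M s b
  | FAnd f g => tand (sat f) (sat g)
  | FTensor _ f g => ttensor (sat f) (sat g)
  | FOr f g => tor (sat f) (sat g)
  | FImp f g => timp (sat f) (sat g)
  | FBox f => tbox (sat f)
  | FDia f => tdia (sat f)
  end.

Arguments sat {Var L} M f X.

Lemma sat_emb (Var : Type) (L : logic) (M : model Var) (a : cform Var L) :
  sat M (emb a) = csat M a.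
Proof. by elim: a => //= [a -> b ->|h a -> b ->|a -> b ->|a ->|a ->]. Qed.

Definition entails (Var : Type) (L : logic) (f g : form Var L) : Prop :=
  forall (M : model Var) (X : set M), sat M f X -> sat M g X.

Definition FLem (Var : Type) (L : logic) (f : form Var L) := (f :\/: :~ f)%F.

(* Conjunctions are bracketed to the left. *)
Definition dep_def (Var : Type) (L : logic) (s : seq (cform Var L))
    (b : cform Var L) : form Var L :=
  match s with
  | [::] => FLem b
  | a :: s' =>
      FImp (foldl (fun f (c : cform Var L) => FAnd f (FLem c)) (FLem a) s')
           (FLem b)
  end.

Inductive hilbert_ax (Var : Type) (L : logic) : form Var L -> Prop :=
  | ax_K f g : hilbert_ax (f :->: (g :->: f))
  | ax_S f g h :
      hilbert_ax ((f :->: (g :->: h)) :->: ((f :->: g) :->: (f :->: h)))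
  | ax_andl f g : hilbert_ax (f :/\: g :->: f)
  | ax_andr f g : hilbert_ax (f :/\: g :->: g)
  | ax_andI f h : hilbert_ax (f :->: (h :->: (f :/\: h)))
  | ax_orl f g : hilbert_ax (f :->: f :\/: g)
  | ax_orr f g : hilbert_ax (g :->: f :\/: g)
  | ax_orE f g h :
      hilbert_ax ((f :->: h) :->: ((g :->: h) :->: (f :\/: g :->: h)))
  | ax_botE f : hilbert_ax (FBot :->: f)
  | ax_split (a : cform Var L) f g :
      hilbert_ax ((a :->: (f :\/: g)) :->: (a :->: f) :\/: (a :->: g))
  | ax_dne (a : cform Var L) : hilbert_ax (:~ :~ a :->: a)
  | ax_boxK f g : hilbert_ax (:[] (f :->: g) :->: (:[] f :->: :[] g))
  | ax_diaK f g : hilbert_ax (:[] (f :->: g) :->: (:<> f :->: :<> g))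
  | ax_dia_bot : hilbert_ax (:~ :<> FBot)
  | ax_dia_or f g : hilbert_ax (:<> (f :\/: g) :->: (:<> f :\/: :<> g))
  | ax_dia_box f g : hilbert_ax ((:<> f :->: :[] g) :->: :[] (f :->: g))
  | ax_dep s b : hilbert_ax (FDep s b :<->: dep_def s b)
  | ax_tensorI (t : has_tensor L) f g : hilbert_ax (f :->: FTensor t f g)
  | ax_tensorE (t : has_tensor L) f g (a : cform Var L) :
      hilbert_ax ((f :->: a) :->: ((g :->: a) :->: (FTensor t f g :->: a)))
  | ax_tensor_mono (t : has_tensor L) f g h k :
      hilbert_ax
        ((f :->: h) :->: ((g :->: k) :->: (FTensor t f g :->: FTensor t h k)))
  | ax_tensorC (t : has_tensor L) f g :
      hilbert_ax (FTensor t f g :->: FTensor t g f)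
  | ax_tensorA (t : has_tensor L) f g h :
      hilbert_ax (FTensor t f (FTensor t g h) :->: FTensor t (FTensor t f g) h)
  | ax_tensor_or (t : has_tensor L) f g h :
      hilbert_ax (FTensor t f (g :\/: h) :->: FTensor t f g :\/: FTensor t f h)
  | ax_nbox (a : cform Var L) : hilbert_ax (:~ :[] a :->: :<> :~ a)
  | ax_box_or f g : hilbert_ax (:[] (f :\/: g) :->: (:[] f :\/: :[] g)).

Inductive provable (Var : Type) (L : logic) : form Var L -> Prop :=
  | provable_ax f : hilbert_ax f -> provable f
  | provable_mp f g : provable f -> provable (f :->: g) -> provable g
  | provable_nec f : provable f -> provable (:[] f).

(* Necessitation is available for theorems only, through [derives_thm]. *)
Inductive derives (Var : Type) (L : logic) (hyp : form Var L) :
    form Var L -> Prop :=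
  | derives_hyp : derives hyp hyp
  | derives_thm f : provable f -> derives hyp f
  | derives_mp f g : derives hyp f -> derives hyp (f :->: g) -> derives hyp g.

(* Main.v *)
(** The axioms make every connective distribute over the disjunction [:\/:], so
    every formula is provably equivalent to a disjunction of classical formulas.
    Classical formulas are flat: a team satisfies them iff each of its worlds
    does in the usual Kripke sense.  Hence the truth lemma of the ordinary
    canonical model lifts to teams, and the team of all worlds containing a
    classical formula [a] decides which disjunct of a normal form [a] entails. *)

From mathcomp Require Import all_boot boolp classical_sets.
Require Import Defs.

Set Implicit Arguments.
Unset Strict Implicit.
Unset Printing Implicit Defensive.

Local Open Scope classical_set_scope.

(** * Kripke semantics of classical formulas *)

Fixpoint ksat (Var : Type) (L : logic) (M : model Var) (a : cform Var L) :
    set M :=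
  match a with
  | CVar p => valuation p
  | CBot => set0
  | CAnd a b => ksat a `&` ksat b
  | CTensor _ a b => ksat a `|` ksat b
  | CImp a b => [set w | ksat a w -> ksat b w]
  | CBox a => [set w | forall v, acc w v -> ksat a v]
  | CDia a => [set w | exists2 v, acc w v & ksat a v]
  end.

Arguments ksat {Var L} M a.

Section Semantics.
Context (Var : Type) (L : logic) (M : model Var).
Implicit Types (a b : cform Var L) (f g : form Var L) (X Y : set M).

Lemma reachS X Y : Y `<=` X -> reach Y `<=` reach X.
Proof. by move=> sYX w [v Yv vw]; exists v => //; apply: sYX. Qed.

(** Induction on [a]: where the team clause asks for witness teams, pointwise truth supplies the
    largest candidates, and singleton subteams recover truth at a world. *)
Lemma csat_flat a X : csat M a X <-> X `<=` ksat M a.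
Proof.
elim: a X => [p||a IHa b IHb|t a IHa b IHb|a IHa b IHb|a IHa|a IHa] X //=.
- by rewrite /tbot /= subset0.
- by rewrite /tand /= IHa IHb subsetI.
- split=> [[Y [Z [-> /IHa Ya /IHb Zb]]]|Xab]; first exact: setUSS.
  exists (X `&` ksat M a), (X `&` ksat M b); split.
  + by rewrite -setIUr; apply/esym/setIidPl.
  + by apply/IHa => w [].
  + by apply/IHb => w [].
- split=> [Xab w Xw aw|Xab Y sYX /IHa Ya].
    have : csat M b [set w].
      by apply: Xab => [_ ->//|]; apply/IHa => _ ->.
    by move/IHb; apply.
  by apply/IHb => w Yw; apply: Xab; [apply: sYX|apply: Ya].
- rewrite /tbox /= IHa; split=> [Xa w Xw v wv|Xa v [w Xw wv]].
    by apply: Xa; exists w.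
  exact: Xa wv.
- split=> [[Y [_ XY] /IHa Ya] w Xw|Xa].
    by have [v [Yv [_ -> wv]]] := XY w Xw; exists v => //; apply: Ya.
  (* All successors of [X] at which [a] holds. *)
  exists (reach X `&` ksat M a); last by apply/IHa => w [].
  split=> [w []//|w Xw]; have [v wv av] := Xa w Xw.
  by exists v; split; [split=> //; exists w|exists w].
Qed.

Lemma csat_set1 a w : csat M a [set w] <-> ksat M a w.
Proof. by rewrite csat_flat; split=> [|aw _ ->]; [apply|]. Qed.

(** Witness teams for [X] are cut down to [Y], or to [reach Y] in the case of diamond. *)
Lemma sat_down f X Y : Y `<=` X -> sat M f X -> sat M f Y.
Proof.
elim: f X Y => [p||s b|f IHf g IHg|t f IHf g IHg|f IHf g IHg|f IHf g IHg
  |f IHf|f IHf] X Y sYX /=.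
- exact: subset_trans.
- by rewrite /tbot /= => X0; rewrite X0 subset0 in sYX.
- by move=> Xd w u /sYX Xw /sYX Xu; apply: Xd.
- by move=> [/(IHf _ _ sYX) ? /(IHg _ _ sYX) ?].
- move=> [X1 [X2 [XE X1f X2g]]]; exists (Y `&` X1), (Y `&` X2); split.
  + by rewrite -setIUr -XE; apply/esym/setIidPl.
  + by apply: IHf X1f => w [].
  + by apply: IHg X2g => w [].
- by move=> [/(IHf _ _ sYX) ?|/(IHg _ _ sYX) ?]; [left|right].
- by move=> Xfg Z sZY; apply: Xfg; apply: subset_trans sYX.
- by apply: IHf; apply: reachS.
- move=> [Z [sZX XZ] Zf]; exists (Z `&` reach Y); last by apply: IHf Zf => w [].
  split=> [w []//|w Yw]; have [v [Zv wv]] := XZ w (sYX w Yw).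
  exists v; split=> //; split=> //.
  by case: wv => _ -> wv; exists w.
Qed.

Lemma sat0 f : sat M f set0.
Proof.
have reach0 : reach (@set0 M) = set0 by rewrite -subset0 => w [].
elim: f => [p||s b|f IHf g IHg|t f IHf g IHg|f IHf g IHg|f IHf g IHg
  |f IHf|f IHf] //=.
- by exists set0, set0; rewrite setU0.
- by left.
- by move=> Y; rewrite subset0 => ->.
- by rewrite /tbox /= reach0.
- by exists set0 => //; split=> // w [].
Qed.

(** * Soundness of the axioms *)

Lemma sat_FLem a X :
  sat M (FLem a) X <->
  (forall w u, X w -> X u -> ksat M a w -> ksat M a u).
Proof.
(* Both disjuncts are displayed as embedded classical formulas, so that flatness applies to each. *)
rewrite /FLem -[FNeg a]/(emb (CImp a CBot)).
rewrite -[sat M _ X]/(sat M (emb a) X \/ sat M (emb (CImp a CBot)) X).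
rewrite !sat_emb !csat_flat; split=> [[Xa w u _ Xu _|Xna w u Xw _ aw]|Xa].
- exact: Xa.
- by case: (Xna w Xw).
- have [[w [Xw aw]]|nXa] := pselect (exists w, X w /\ ksat M a w).
    by left=> u Xu; apply: Xa aw.
  by right=> w Xw aw; case: nXa; exists w.
Qed.

Lemma sat_dep_def (s : seq (cform Var L)) b X :
  sat M (dep_def s b) X <-> tdep s b X.
Proof.
pose const a Y := forall w u, Y w -> Y u -> ksat M a w -> ksat M a u.
(* Dependence restated over subteams, matching the team clause of implication; conversely, the
   two-world subteams [[set w; u]] suffice. *)
have tdepE : tdep s b X <->
    forall Y, Y `<=` X -> (forall a, List.In a s -> const a Y) -> const b Y.
  split=> [Xd Y sYX Ys w u Yw Yu|Xd w u Xw Xu wu].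
    rewrite -!csat_set1; apply: (Xd w u (sYX _ Yw) (sYX _ Yu) _).1 => a sa.
    by rewrite !csat_set1; split; apply: Ys.
  have [sYX Ys] : [set w; u] `<=` X /\
      forall a, List.In a s -> const a [set w; u].
    split=> [v [->|->]//|a /wu]; rewrite !csat_set1 => -[awu auw].
    by move=> v v' [->|->] [->|->].
  rewrite !csat_set1; split; apply: (Xd _ sYX Ys); by [left|right].
(* The accumulator [f] stays arbitrary because [foldl] changes it at every step. *)
have conjE f s' Y : sat M (foldl (fun f (c : cform Var L) => FAnd f (FLem c)) f s') Y
    <-> sat M f Y /\ forall a, List.In a s' -> const a Y.
  elim: s' f => [|c s' IH] f /=; first by split=> [|[]].
  rewrite IH /= /tand /= -/(sat M (FLem c) Y).
  split=> [[[Yf /sat_FLem Yc] Ys]|[Yf Ys]].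
    by split=> // a [<-//|]; apply: Ys.
  split; last by move=> a sa; apply: Ys; right.
  by split=> //; apply/sat_FLem; apply: Ys; left.
rewrite tdepE; case: s {tdepE} => [|a s].
  rewrite sat_FLem; split=> [Xb Y sYX _ w u Yw Yu|Xb]; last exact: Xb.
  by apply: Xb; apply: sYX.
split=> Xd Y sYX.
  move=> Ys; apply/sat_FLem; apply: Xd => //; apply/conjE; split.
    by apply/sat_FLem; apply: Ys; left.
  by move=> c sc; apply: Ys; right.
move/conjE => [/sat_FLem Ya Ys]; apply/sat_FLem; apply: Xd => // c.
by case=> [<-//|]; apply: Ys.
Qed.

Lemma hilbert_ax_sound f : hilbert_ax f -> forall X, sat M f X.
Proof.
case=> {f} [f g|f g h|f g|f g|f h|f g|f g|f g h|f|a f g|a|f g|f g||f g|f g|s b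
  |t f g|t f g a|t f g h k|t f g|t f g h|t f g h|a|f g] X;
  try by split=> Z _ /sat_dep_def.
all: move=> Y sYX /=.
- by move=> Yf Z sZY _; apply: sat_down Yf.
- move=> Yfgh Z sZY Zfg U sUZ Uf; apply: (Yfgh U) => //.
  + exact: subset_trans sZY.
  + exact: Zfg.
- by case.
- by case.
- by move=> Yf Z sZY Zh; split=> //; apply: sat_down Yf.
- by left.
- by right.
- move=> Yfh Z sZY Zgh U sUZ [Uf|Ug]; last exact: Zgh.
  by apply: Yfh => //; apply: subset_trans sZY.
- by move=> ->; apply: sat0.
(* By flatness this is the largest subteam of [Y] satisfying [a]; the disjunct it chooses passes to
   all others by downward closure. *)
- move=> Ya; have [] : sat M (f :\/: g)%F (Y `&` ksat M a).
    apply: Ya => [w []//|]; rewrite sat_emb; apply/csat_flat => w [] //.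
  + move=> Yf; left=> Z sZY; rewrite sat_emb => /csat_flat Za.
    by apply: sat_down Yf => w Zw; split; [apply: sZY|apply: Za].
  + move=> Yg; right=> Z sZY; rewrite sat_emb => /csat_flat Za.
    by apply: sat_down Yg => w Zw; split; [apply: sZY|apply: Za].
- move=> Ya; have /csat_flat {}Ya : csat M (CImp (CImp a CBot) CBot) Y.
    by rewrite -sat_emb.
  rewrite sat_emb; apply/csat_flat => w Yw.
  by apply: contrapT => naw; case: (Ya w Yw).
- move=> Yfg Z sZY Zf; apply: Yfg => //; exact: reachS.
- move=> Yfg Z sZY [U [sUZ ZU] Uf]; exists U => //; apply: Yfg => //.
  by apply: subset_trans sUZ _; apply: reachS.

- move=> [Z [_ YZ] Z0]; rewrite Z0 in YZ.
  by rewrite /tbot /= -subset0 => w /YZ [v []].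
- by move=> [Z YZ [Zf|Zg]]; [left|right]; exists Z.
- move=> Yfg Z sZY Zf.
  (* Worlds of [Y] without a successor in [Z] are dropped, so that [Z] witnesses the diamond on the
     remaining team. *)
  pose Y' := [set w | Y w /\ exists2 v, Z v & acc w v].
  suff YZ : team_acc Y' Z.
    apply: sat_down (Yfg Y' _ (ex_intro2 _ _ Z YZ Zf)); first exact: YZ.1.
    by move=> w [].
  split=> [v Zv|w [Yw [v Zv wv]]].
    by have [w Yw wv] := sZY v Zv; exists w => //; split=> //; exists v.
  by exists v; split=> //; exists w.
- by move=> Yf; exists Y, set0; rewrite setU0; split=> //; apply: sat0.
(* Since [a] is flat, its truth on both parts gives truth on their union. *)
- move=> Yfa Z sZY Zga U sUZ [U1 [U2 [UE U1f U2g]]].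
  rewrite sat_emb; apply/csat_flat; rewrite UE; rewrite UE in sUZ.
  have {sUZ} [sU1Z sU2Z] : U1 `<=` Z /\ U2 `<=` Z.
    by split=> w Uw; apply: sUZ; [left|right].
  rewrite subUset; split; apply/csat_flat; rewrite -sat_emb.
    by apply: Yfa => //; apply: subset_trans sZY.
  exact: Zga.
- move=> Yfh Z sZY Zgk U sUZ [U1 [U2 [UE U1f U2g]]].
  exists U1, U2; split=> //; rewrite UE in sUZ.
    apply: Yfh => // w U1w; apply/sZY/sUZ; by left.
  by apply: Zgk => // w U2w; apply: sUZ; right.
- by move=> [Y1 [Y2 [-> Y1f Y2g]]]; exists Y2, Y1; rewrite setUC.
- move=> [Y1 [_ [-> Y1f [Y2 [Y3 [-> Y2g Y3h]]]]]]; exists (Y1 `|` Y2), Y3.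
  by rewrite setUA; split=> //; exists Y1, Y2.
- by move=> [Y1 [Y2 [-> Y1f [Y2g|Y2h]]]]; [left|right]; exists Y1, Y2.
- move=> Yna; exists (reach Y `&` ~` ksat M a).
    split=> [w []//|w Yw].
    have /existsNP[v /not_implyP[wv nav]] : ~ forall v, acc w v -> ksat M a v.
      (* If all successors of [w] satisfied [a], the subteam [[set w]] would satisfy the boxed
         formula, and the premise would make it empty. *)
      move=> wa; suff w0 : [set w] = set0 by rewrite -[False]/(@set0 M w) -w0.
      apply: Yna => [_ ->//|]; rewrite /tbox /= sat_emb; apply/csat_flat.
      by move=> v [_ -> wv]; apply: wa.
    by exists v; split; [split=> //; exists w|exists w].
  move=> Z sZ; rewrite sat_emb => /csat_flat Za.
  by rewrite /tbot /= -subset0 => w Zw; case: (sZ w Zw) => _; apply; apply: Za.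
- by case; [left|right].
Qed.

Lemma provable_sound f : provable f -> forall X, sat M f X.
Proof.
elim=> {f} [f /hilbert_ax_sound//|f g _ IHf _ IHfg X|f _ IHf X].
  by apply: (IHfg X X); [|apply: IHf].
exact: IHf.
Qed.

End Semantics.

(** * Derived rules of the Hilbert system *)

Section Hilbert.
Context (Var : Type) (L : logic).
Implicit Types (a b c : cform Var L) (f g h k : form Var L).

Definition le f g := provable (f :->: g).

Lemma provable_K f g : provable f -> le g f.
Proof. by move=> /provable_mp; apply; apply/provable_ax/ax_K. Qed.

Lemma provable_S f g h : le f (g :->: h) -> le f g -> le f h.
Proof.
move=> fgh /provable_mp; apply; apply: provable_mp fgh _.
exact/provable_ax/ax_S.
Qed.

Lemma le_refl f : le f f.
Proof. by apply: (@provable_S f (f :->: f)); apply/provable_ax/ax_K. Qed.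

Lemma le_trans g f h : le f g -> le g h -> le f h.
Proof. by move=> fg /(provable_K f)/provable_S; apply. Qed.

Lemma le_andl f g : le (f :/\: g) f.
Proof. exact/provable_ax/ax_andl. Qed.

Lemma le_andr f g : le (f :/\: g) g.
Proof. exact/provable_ax/ax_andr. Qed.

Lemma le_and f g h : le h f -> le h g -> le h (f :/\: g).
Proof.
move=> hf; apply: provable_S; apply: le_trans hf _; exact/provable_ax/ax_andI.
Qed.

Lemma le_orl f g : le f (f :\/: g).
Proof. exact/provable_ax/ax_orl. Qed.

Lemma le_orr f g : le g (f :\/: g).
Proof. exact/provable_ax/ax_orr. Qed.

Lemma le_or f g h : le f h -> le g h -> le (f :\/: g) h.
Proof.
move=> fh /provable_mp; apply; apply: provable_mp fh _; exact/provable_ax/ax_orE.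
Qed.

(** This residuation law plays the part of the deduction theorem in the derivations below. *)
Lemma le_curry f g h : le (f :/\: g) h <-> le f (g :->: h).
Proof.
split=> [fgh|fgh]; last first.
  apply: provable_S _ (le_andr f g); exact: le_trans (le_andl f g) fgh.
apply: (@le_trans (g :->: (f :/\: g))); first exact/provable_ax/ax_andI.
by apply: provable_mp (provable_K g fgh) _; apply/provable_ax/ax_S.
Qed.

Lemma le_apply f g h : le f g -> le f (g :->: h) -> le f h.
Proof. by move=> fg fgh; apply: provable_S fgh fg. Qed.

Lemma le_imp f f' g g' : le f' f -> le g g' -> le (f :->: g) (f' :->: g').
Proof.
move=> f'f gg'; apply/le_curry; apply: le_trans gg'.
apply: le_apply (le_andl _ _); exact: le_trans (le_andr _ _) f'f.
Qed.

Lemma le_and2 f f' g g' : le f f' -> le g g' -> le (f :/\: g) (f' :/\: g').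
Proof.
move=> ff' gg'; apply: le_and.
  exact: le_trans (le_andl _ _) ff'.
exact: le_trans (le_andr _ _) gg'.
Qed.

Lemma le_or2 f f' g g' : le f f' -> le g g' -> le (f :\/: g) (f' :\/: g').
Proof.
move=> ff' gg'; apply: le_or.
  exact: le_trans ff' (le_orl _ _).
exact: le_trans gg' (le_orr _ _).
Qed.

Lemma le_box f g : le f g -> le (:[] f) (:[] g).
Proof.
move=> /provable_nec /provable_mp; apply; exact/provable_ax/ax_boxK.
Qed.

Lemma le_dia f g : le f g -> le (:<> f) (:<> g).
Proof.
move=> /provable_nec /provable_mp; apply; exact/provable_ax/ax_diaK.
Qed.

Lemma le_tensor t f f' g g' :
  le f f' -> le g g' -> le (FTensor t f g) (FTensor t f' g').
Proof.
move=> ff' /provable_mp; apply; apply: provable_mp ff' _.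
exact/provable_ax/ax_tensor_mono.
Qed.

(** * Disjunctive normal forms *)

Definition equiv f g := le f g /\ le g f.

Lemma equiv_trans g f h : equiv f g -> equiv g h -> equiv f h.
Proof. by move=> [fg gf] [gh hg]; split; apply: le_trans; eassumption. Qed.

Lemma equiv_and f f' g g' :
  equiv f f' -> equiv g g' -> equiv (f :/\: g) (f' :/\: g').
Proof. by move=> [? ?] [? ?]; split; apply: le_and2. Qed.

Lemma equiv_or f f' g g' :
  equiv f f' -> equiv g g' -> equiv (f :\/: g) (f' :\/: g').
Proof. by move=> [? ?] [? ?]; split; apply: le_or2. Qed.

Lemma equiv_imp f f' g g' :
  equiv f f' -> equiv g g' -> equiv (f :->: g) (f' :->: g').
Proof. by move=> [? ?] [? ?]; split; apply: le_imp. Qed.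

Lemma equiv_box f f' : equiv f f' -> equiv (:[] f) (:[] f').
Proof. by move=> [? ?]; split; apply: le_box. Qed.

Lemma equiv_dia f f' : equiv f f' -> equiv (:<> f) (:<> f').
Proof. by move=> [? ?]; split; apply: le_dia. Qed.

Lemma equiv_tensor t f f' g g' :
  equiv f f' -> equiv g g' -> equiv (FTensor t f g) (FTensor t f' g').
Proof. by move=> [? ?] [? ?]; split; apply: le_tensor. Qed.

Lemma equiv_and_orl f g h :
  equiv ((f :\/: g) :/\: h) ((f :/\: h) :\/: (g :/\: h)).
Proof.
split; first by apply/le_curry; apply: le_or; apply/le_curry;
  [apply: le_orl|apply: le_orr].
apply: le_or; apply: le_and2; try exact: le_refl.
  exact: le_orl.
exact: le_orr.
Qed.

Lemma equiv_andC f g : equiv (f :/\: g) (g :/\: f).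
Proof. by split; apply: le_and; by [apply: le_andr|apply: le_andl]. Qed.

Lemma equiv_imp_orl f g h :
  equiv ((f :\/: g) :->: h) ((f :->: h) :/\: (g :->: h)).
Proof.
split.
  by apply: le_and; apply: le_imp;
    [apply: le_orl|apply: le_refl|apply: le_orr|apply: le_refl].
apply: (@provable_S _ (g :->: h)); last exact: le_andr.
apply: le_trans (le_andl _ _) _; exact/provable_ax/ax_orE.
Qed.

Lemma equiv_imp_orr a f g :
  equiv (a :->: (f :\/: g)) ((a :->: f) :\/: (a :->: g)).
Proof.
split; first exact/provable_ax/ax_split.
by apply: le_or; apply: le_imp;
  [apply: le_refl|apply: le_orl|apply: le_refl|apply: le_orr].
Qed.

Lemma equiv_box_or f g : equiv (:[] (f :\/: g)) (:[] f :\/: :[] g).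
Proof.
split; first exact/provable_ax/ax_box_or.
by apply: le_or; apply: le_box; [apply: le_orl|apply: le_orr].
Qed.

Lemma equiv_dia_or f g : equiv (:<> (f :\/: g)) (:<> f :\/: :<> g).
Proof.
split; first exact/provable_ax/ax_dia_or.
by apply: le_or; apply: le_dia; [apply: le_orl|apply: le_orr].
Qed.

Lemma equiv_tensorC t f g : equiv (FTensor t f g) (FTensor t g f).
Proof. by split; apply/provable_ax/ax_tensorC. Qed.

Lemma equiv_tensor_orr t f g h :
  equiv (FTensor t f (g :\/: h)) (FTensor t f g :\/: FTensor t f h).
Proof.
split; first exact/provable_ax/ax_tensor_or.
by apply: le_or; apply: le_tensor;
  [apply: le_refl|apply: le_orl|apply: le_refl|apply: le_orr].
Qed.

(** Disjunctions may be nested in any way, so no flattening into a list is required. *)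
Inductive nf : form Var L -> Prop :=
  | nf_emb a : nf a
  | nf_or f g : nf f -> nf g -> nf (f :\/: g).

Definition has_nf f := exists2 g, nf g & equiv f g.

Lemma nf_has_nf f : nf f -> has_nf f.
Proof. by move=> nff; exists f => //; split; apply: le_refl. Qed.

Lemma has_nf_equiv f g : equiv f g -> has_nf g -> has_nf f.
Proof. by move=> fg [h nfh gh]; exists h => //; apply: equiv_trans gh. Qed.

Lemma has_nf_or f g : has_nf f -> has_nf g -> has_nf (f :\/: g).
Proof.
move=> [f' nff ff'] [g' nfg gg']; exists (f' :\/: g')%F; first exact: nf_or.
exact: equiv_or.
Qed.

Lemma has_nf_and f g : has_nf f -> has_nf g -> has_nf (f :/\: g).
Proof.
move=> [f' nff ff'] [g' nfg gg']; apply: has_nf_equiv (equiv_and ff' gg') _.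
elim: nff => {f f' ff'} [a|f1 f2 _ IH1 _ IH2]; last first.
  apply: has_nf_equiv (equiv_and_orl _ _ _) _; exact: has_nf_or.
elim: nfg => {g g' gg'} [b|g1 g2 _ IH1 _ IH2].
  exact/nf_has_nf/(nf_emb (CAnd a b)).
apply: has_nf_equiv (equiv_andC _ _) _.
apply: has_nf_equiv (equiv_and_orl _ _ _) _.
by apply: has_nf_or; apply: has_nf_equiv (equiv_andC _ _) _.
Qed.

(** The antecedent is split first, into a conjunction of implications; [ax_split] can distribute
    over the consequent only once the antecedent is classical. *)
Lemma has_nf_imp f g : has_nf f -> has_nf g -> has_nf (f :->: g).
Proof.
move=> [f' nff ff'] [g' nfg gg']; apply: has_nf_equiv (equiv_imp ff' gg') _.
elim: nff => {f f' ff'} [a|f1 f2 _ IH1 _ IH2]; last first.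
  apply: has_nf_equiv (equiv_imp_orl _ _ _) _; exact: has_nf_and.
elim: nfg => {g g' gg'} [b|g1 g2 _ IH1 _ IH2].
  exact/nf_has_nf/(nf_emb (CImp a b)).
apply: has_nf_equiv (equiv_imp_orr _ _ _) _; exact: has_nf_or.
Qed.

Lemma has_nf_box f : has_nf f -> has_nf (:[] f).
Proof.
move=> [f' nff ff']; apply: has_nf_equiv (equiv_box ff') _.
elim: nff => {f f' ff'} [a|f1 f2 _ IH1 _ IH2].
  exact/nf_has_nf/(nf_emb (CBox a)).
apply: has_nf_equiv (equiv_box_or _ _) _; exact: has_nf_or.
Qed.

Lemma has_nf_dia f : has_nf f -> has_nf (:<> f).
Proof.
move=> [f' nff ff']; apply: has_nf_equiv (equiv_dia ff') _.
elim: nff => {f f' ff'} [a|f1 f2 _ IH1 _ IH2].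
  exact/nf_has_nf/(nf_emb (CDia a)).
apply: has_nf_equiv (equiv_dia_or _ _) _; exact: has_nf_or.
Qed.

(** [ax_tensor_or] distributes in the right argument, so commutativity moves the left one there. *)
Lemma has_nf_tensor t f g : has_nf f -> has_nf g -> has_nf (FTensor t f g).
Proof.
move=> [f' nff ff'] [g' nfg gg']; apply: has_nf_equiv (equiv_tensor t ff' gg') _.
elim: nfg => {g g' gg'} [b|g1 g2 _ IH1 _ IH2]; last first.
  apply: has_nf_equiv (equiv_tensor_orr _ _ _ _) _; exact: has_nf_or.
apply: has_nf_equiv (equiv_tensorC _ _ _) _.
elim: nff => {f f' ff'} [a|f1 f2 _ IH1 _ IH2].
  exact/nf_has_nf/(nf_emb (CTensor t b a)).
apply: has_nf_equiv (equiv_tensor_orr _ _ _ _) _; exact: has_nf_or.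
Qed.

Lemma has_nf_FLem a : has_nf (FLem a).
Proof.
exact/nf_has_nf/(nf_or (nf_emb a))/(nf_emb (CImp a CBot)).
Qed.

Lemma has_nf_dep_def (s : seq (cform Var L)) b : has_nf (dep_def s b).
Proof.
case: s => [|a s]; first exact: has_nf_FLem.
apply: has_nf_imp (has_nf_FLem b).
elim: s (FLem a) (has_nf_FLem a) => //= c s IH f nff.
by apply: IH; apply: has_nf_and nff _; apply: has_nf_FLem.
Qed.

Lemma has_nfP f : has_nf f.
Proof.
elim: f => [p||s b|f ? g ?|t f ? g ?|f ? g ?|f ? g ?|f ?|f ?].
- exact/nf_has_nf/(nf_emb (CVar p)).
- exact/nf_has_nf/(nf_emb CBot).
- apply: has_nf_equiv (has_nf_dep_def s b).
  have ax := provable_ax (ax_dep s b).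
  by split; apply: provable_mp ax _; apply/provable_ax;
    [apply: ax_andl|apply: ax_andr].
- exact: has_nf_and.
- exact: has_nf_tensor.
- exact: has_nf_or.
- exact: has_nf_imp.
- exact: has_nf_box.
- exact: has_nf_dia.
Qed.

(** * The canonical model *)

(** Members are classical, while [provable] is provability in the full system. Theories describe
    worlds, hence closure under Modus Ponens but not under Necessitation. *)
Definition theory (T : set (cform Var L)) :=
  (forall a, provable a -> T a) /\ (forall a b, T a -> T (CImp a b) -> T b).

Definition complete_theory T :=
  [/\ theory T, ~ T CBot & forall a, T a \/ T (CImp a CBot)].

(** By the deduction theorem this set is the theory generated by [T] and [a]; closure under Modus
    Ponens is the axiom [ax_S]. *)
Lemma theory_ext T a : theory T -> theory [set b | T (CImp a b)].
Proof.
move=> [Tp Tmp]; split=> [b bp|b c /= Tab Tabc]; first exact/Tp/provable_K.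
apply: (Tmp _ _ Tab); apply: (Tmp _ _ Tabc); apply: Tp.
exact: (provable_ax (ax_S a b c)).
Qed.

Lemma theory_le T a b : theory T -> le a b -> T a -> T b.
Proof. by move=> [Tp Tmp] ab Ta; apply: Tmp Ta _; apply: Tp. Qed.

Lemma theory_imp T a b : theory T -> T b -> T (CImp a b).
Proof. by move=> thT; apply: theory_le => //; apply/provable_ax/ax_K. Qed.

Lemma theory_id T a : theory T -> T (CImp a a).
Proof. by move=> [Tp _]; apply: Tp; apply: le_refl. Qed.

Lemma theory_dne T a : theory T -> T (CImp (CImp a CBot) CBot) -> T a.
Proof. by move=> thT; apply: theory_le => //; apply/provable_ax/ax_dne. Qed.

Lemma theory_bot T a : theory T -> T CBot -> T a.
Proof. by move=> thT; apply: theory_le => //; apply/provable_ax/ax_botE. Qed.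

(** Reductio: in the extension [U] of [T] by the negation of [b], the first hypothesis refutes [a],
    and then the second yields [b], a contradiction. *)
Lemma theory_em T a b :
  theory T -> T (CImp a b) -> T (CImp (CImp a CBot) b) -> T b.
Proof.
move=> thT Tab Tnab; apply: theory_dne => //.
pose U := [set c | T (CImp (CImp b CBot) c)].
have thU : theory U by apply: theory_ext.
have Unb : U (CImp b CBot) by apply: theory_id.
have Una : U (CImp a CBot).
  have thUa := theory_ext a thU.
  by apply: (thUa.2 b CBot); [apply: (theory_imp _ thT)|apply: (theory_imp _ thU)].
apply: (thU.2 b) => //; apply: (thU.2 (CImp a CBot)) => //.
exact: theory_imp thT Tnab.
Qed.

Lemma lindenbaum T b : theory T -> ~ T b ->
  exists U, [/\ complete_theory U, T `<=` U & ~ U b].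
Proof.
move=> thT nTb.
(* Zorn is applied to the sets [U] to be added to [T], so that the empty chain, whose union is
   empty, also stays in [P]. *)
pose P := [set U | theory (T `|` U) /\ ~ (T `|` U) b].
have [F FP Ftot|U [[thU nUb] maxU]] := @Zorn_bigcup _ P.
  have [->|/set0P[X0 FX0]] := eqVneq F set0.
    by rewrite bigcup_set0; split; rewrite setU0.
  have memF x : (T `|` \bigcup_(X in F) X) x -> exists2 X, F X & (T `|` X) x.
    by move=> [Tx|[X FX Xx]]; [exists X0 => //; left|exists X => //; right].
  split; last by move=> /memF [X /FP[_]].
  split=> [a ap|a c /memF[X FX Xa] /memF[Y FY Yac]].
    by left; apply: thT.1.
  suff [Z FZ Zc] : exists2 Z, F Z & (T `|` Z) c.
    by case: Zc => [Tc|Zc]; [left|right; exists Z].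
  have [XY|YX] := Ftot _ _ FX FY; [exists Y|exists X] => //.
    by have [[_ mp] _] := FP _ FY; apply: mp Yac; apply: setUS Xa.
  by have [[_ mp] _] := FP _ FX; apply: mp Xa _; apply: setUS Yac.
exists (T `|` U); split=> //.
(* By maximality, adding any missing [a] must produce [b]: otherwise the theory extended by [a]
   would be a strictly larger member of [P]. *)
have extb a : ~ (T `|` U) a -> (T `|` U) (CImp a b).
  move=> nUa; apply: contrapT => nUab.
  have sU : T `|` U `<=` [set c | (T `|` U) (CImp a c)].
    by move=> c Uc; apply: theory_imp.
  apply: (maxU [set c | (T `|` U) (CImp a c)]).
    split; first by move=> c Uc; apply: sU; right.
    by move=> sU'; apply: nUa; right; apply: sU'; apply: theory_id.
  have TE : T `|` [set c | (T `|` U) (CImp a c)] =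
      [set c | (T `|` U) (CImp a c)].
    by apply/setUidPr => c Tc; apply: sU; left.
  by split; rewrite TE; [apply: theory_ext|].
split=> // [/(theory_bot b thU)//|a].
have [Ua|nUa] := pselect ((T `|` U) a); first by left.
(* If both [a] and its negation were missing, each would imply [b], and [theory_em] would give
   [b]. *)
right; apply: contrapT => nUna; apply: nUb.
by apply: (@theory_em _ a) => //; apply: extb.
Qed.

Definition canonical_world := {T : set (cform Var L) | complete_theory T}.

Implicit Types w : canonical_world.

Definition canonical_acc w w' := forall a, sval w (CBox a) -> sval w' a.

(** The argument [w] only witnesses that the set of worlds is nonempty. *)
Definition canonical_model (w : canonical_world) : model Var :=
  Model canonical_acc (fun p => [set w | sval w (CVar p)]) (inhabits w).

Lemma box_theory T : theory T -> theory [set a | T (CBox a)].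
Proof.
move=> [Tp Tmp]; split=> [a /provable_nec|a b /= Ta Tab]; first exact: (Tp (CBox a)).
by apply: (Tmp _ _ Ta); apply: (Tmp _ _ Tab); apply: Tp; apply/provable_ax/ax_boxK.
Qed.

(** If the boxed [a] is missing from [w], the formulas boxed in [w] form a theory omitting [a];
    Lindenbaum extends it to a successor omitting [a]. *)
Lemma canonical_box w a :
  (forall w', canonical_acc w w' -> sval w' a) -> sval w (CBox a).
Proof.
move=> wa; apply: contrapT => nwa; have [thw _ _] := svalP w.
have [U [cU wU nUa]] := lindenbaum (box_theory thw) nwa.
by apply: nUa; apply: (wa (exist _ U cU)).
Qed.

(** One half of modal duality: [ax_diaK] carries [a] to [FBot] under the diamond, which [ax_dia_bot]
    refutes. *)
Lemma le_dia_box a : le (:<> a) (:~ :[] :~ a).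
Proof.
apply/le_curry.
apply: (@le_trans (:<> FBot)); last exact/provable_ax/ax_dia_bot.
apply: (le_apply (le_andl _ _)); apply: le_trans (le_andr _ _) _.
exact/provable_ax/ax_diaK.
Qed.

Lemma le_box_dia a : le (:~ :[] :~ a) (:<> a).
Proof.
apply: (@le_trans (:<> :~ :~ a)); first exact/provable_ax/(ax_nbox (CImp a CBot)).
by apply/le_dia/provable_ax/ax_dne.
Qed.

(** Duality reduces this to the box case for the negation of [a], since each world decides [a]. *)
Lemma canonical_dia w a :
  sval w (CDia a) <-> exists2 w', canonical_acc w w' & sval w' a.
Proof.
have [thw nwbot wem] := svalP w; split=> [wa|[w' ww' w'a]].
  apply: contrapT => nwa; apply: nwbot.
  apply: (thw.2 (CBox (CImp a CBot))).
    apply: canonical_box => w' ww'; have [_ _ w'em] := svalP w'.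
    by have [w'a|//] := w'em a; case: nwa; exists w'.
  by apply: (theory_le thw _ wa); apply: le_dia_box.
apply: (@theory_le _ (CImp (CBox (CImp a CBot)) CBot)) => //.
  exact: le_box_dia.
have [wna|//] := wem (CBox (CImp a CBot)).
by have [thw' nw'bot _] := svalP w'; case: nw'bot; apply: thw'.2 (ww' _ wna).
Qed.

Lemma truth w0 a (w : canonical_model w0) : ksat _ a w <-> sval w a.
Proof.
elim: a w => [p||a IHa b IHb|t a IHa b IHb|a IHa b IHb|a IHa|a IHa] w /=;
  have [thw nwbot wem] := svalP w.
- by [].
- by split.
- rewrite /setI /= IHa IHb; split=> [[wa wb]|wab].
    by apply: thw.2 wb _; apply: theory_le wa => //; apply/provable_ax/ax_andI.
  by split; apply: theory_le wab => //; [apply: le_andl|apply: le_andr].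
- have leI c d : le c (CTensor t c d) by apply/provable_ax/ax_tensorI.
  rewrite /setU /= IHa IHb; split=> [[wa|wb]|wab].
  + exact: theory_le thw (leI a b) wa.
  + apply: theory_le wb => //; apply: le_trans (leI _ a) _.
    exact/provable_ax/ax_tensorC.
  (* A world refuting both parts refutes the tensor, by [ax_tensorE] with the classical conclusion
     [CBot]. *)
  + have [wa|wna] := wem a; first by left.
    have [wb|wnb] := wem b; first by right.
    case: nwbot; apply: thw.2 wab _; apply: thw.2 wnb _.
    by apply: theory_le wna => //; apply/provable_ax/(ax_tensorE t a b CBot).
- rewrite IHa IHb; split=> [wab|wab wa]; last exact: thw.2 wab.
  have [/wab wb|wna] := wem a; first exact: theory_imp.
  apply: theory_le wna => //; apply: le_imp; first exact: le_refl.
  exact/provable_ax/ax_botE.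
- split=> [wa|wa v wv]; last by apply/IHa; apply: wv.
  by apply: canonical_box => v /wa /IHa.
- rewrite canonical_dia; split=> -[v wv /IHa va]; by exists v.
Qed.

Lemma csat_canonical w0 a (X : set (canonical_model w0)) :
  csat _ a X <-> forall w, X w -> sval w a.
Proof.
by rewrite csat_flat; split=> Xa w /Xa /truth.
Qed.

Lemma provable_theory : theory [set a : cform Var L | provable a].
Proof. by split=> // a b; apply: provable_mp. Qed.

(** * Completeness *)

(* The team of all complete theories containing [a] satisfies [a], hence a
   single classical disjunct of [g]. *)
Lemma entails_nf_le a g : nf g -> entails a g -> le a g.
Proof.
move=> nfg ag; apply: contrapT => nag.
(* The assumed underivability makes the system consistent, which provides the world that
   [canonical_model] takes. *)
have nbot : ~ [set c : cform Var L | provable c] CBot.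
  move=> /provable_mp bot; apply/nag/bot/provable_ax/ax_botE.
have [U0 [cU0 _ _]] := lindenbaum provable_theory nbot.
pose M := canonical_model (exist _ U0 cU0).
pose X : set M := [set w | sval w a].
have {ag} : sat M g X by apply: ag; rewrite sat_emb; apply/csat_canonical.
(* With the team [X] fixed, the induction on [g] goes through: satisfying a disjunction on [X] means
   satisfying one disjunct on all of [X]. *)
apply: contra_not nag => {}.
elim: nfg => [b|g1 g2 _ IH1 _ IH2]; last first.
  by move=> [/IH1|/IH2] /le_trans; apply; [apply: le_orl|apply: le_orr].
rewrite sat_emb => /csat_canonical Xb; apply: contrapT => nab.
(* The classical consequences of [a] omit [b], so some world of [X] omits [b]. *)
have [U [cU aU nUb]] := lindenbaum (theory_ext a provable_theory) nab.
apply: nUb; apply: (Xb (exist _ U cU)); apply: aU; exact: le_refl.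
Qed.

(** Soundness transfers the entailment to the normal forms; a disjunction on the left then entails
    [g'] only if each disjunct does, which leaves the classical case. *)
Lemma entails_le f g : entails f g -> le f g.
Proof.
have le_entails h k : le h k -> entails h k.
  by move=> hk M X Xh; exact: (provable_sound (M := M) hk X X).
have [f' nff [ff' /le_entails f'f]] := has_nfP f.
have [g' nfg [/le_entails gg' g'g]] := has_nfP g.
move=> fg; apply: le_trans ff' (le_trans _ g'g).
have {f'f fg gg'} : entails f' g' by move=> M X /f'f /fg /gg'.
elim: nff => {f'} [a|f1 f2 _ IH1 _ IH2]; first exact: entails_nf_le.
move=> fg; apply: le_or; [apply: IH1|apply: IH2] => M X Xf; apply: fg;
  by [left|right].
Qed.

End Hilbert.

Theorem theorem2p8 (Var : Type) (L : logic) (phi psi : form Var L) :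
  entails phi psi -> derives phi psi.
Proof.
move=> /entails_le le_phi_psi.
by apply: (@derives_mp _ _ _ phi); [apply: derives_hyp|apply: derives_thm].
Qed.
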